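(* Let $\lambda$ be a nonzero real number and let $p(x)\in\mathbb{C}[x]$ have degree $n$. Then $$p(x)=\sum_{k=0}^{n}a_k\,\beta_{k,\lambda}(x),$$ where $$a_0=g(t)p(x)\big|_{x=0}=\Big\langle \frac{e^{t}-1}{t}\,\Big|\,\frac{\lambda t}{e^{\lambda t}-1}p(x)\Big\rangle=\int_0^1 p\big(\lambda\mathbf{B}(\tfrac{u}{\lambda})\big)\,du,$$ and, for $k=1,2,\dots,n$, \begin{align*} a_k&=\frac{1}{k!}\,(f(t))^{k-1}\big(p(x+1)-p(x)\big)\Big|_{x=0} =\frac{1}{k!\,\lambda^{k-1}}\big\langle (e^{\lambda t}-1)^{k-1}\,\big|\,p(x+1)-p(x)\big\rangle\\ &=\frac{1}{k!\,\lambda^{k-1}}\,\big(\Delta_\lambda^{k-1}\Delta p\big)(0) =\frac{1}{k!\,\lambda^{k-1}}\sum_{j=0}^{k-1}\binom{k-1}{j}(-1)^{k-1-j}\big(p(1+j\lambda)-p(j\lambda)\big)\\ &=\frac{1}{k}\sum_{l=k-1}^{n}S_2(l,k-1)\frac{\lambda^{l-k+1}}{l!}\big(p^{(l)}(1)-p^{(l)}(0)\big), \end{align*} with $g(t)=\frac{\lambda(e^t-1)}{e^{\lambda t}-1}$ and $f(t)=\frac{1}{\lambda}(e^{\lambda t}-1)$.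
   Context: Degenerate Bernoulli polynomials $\beta_{n,\lambda}(x)$ are defined by $\frac{t}{(1+\lambda t)^{1/\lambda}-1}(1+\lambda t)^{x/\lambda}=\sum_{n\ge0}\beta_{n,\lambda}(x)\frac{t^n}{n!}$. Bernoulli polynomials $B_n(x)$ are defined by $\frac{t}{e^t-1}e^{xt}=\sum_{n\ge0}B_n(x)\frac{t^n}{n!}$. Umbral conventions: a formal power series $h(t)=\sum_{k\ge0}c_k\frac{t^k}{k!}\in\mathbb{C}[[t]]$ acts on polynomials as the differential operator $h(t)x^m=\sum_{k=0}^m\binom{m}{k}c_kx^{m-k}$ (i.e. $t=d/dx$), and as a linear functional by $\langle h(t)\mid x^m\rangle=c_m$, so that $\langle h(t)\mid q(x)\rangle=(h(t)q)(x)|_{x=0}$. If $p(x)=\sum_{i=0}^n b_ix^i$, the umbral composition $p(\lambda\mathbf{B}(\frac{x}{\lambda}))$ denotes the polynomial $\sum_{i=0}^n b_i\lambda^iB_i(\frac{x}{\lambda})$ in $x$. $\Delta_a q(x)=q(x+a)-q(x)$, $\Delta=\Delta_1$, and powers denote iterates. $S_2(l,m)$ are Stirling numbers of the second kind, $\frac{1}{m!}(e^t-1)^m=\sum_{l\ge m}S_2(l,m)\frac{t^l}{l!}$. $p^{(l)}$ is the $l$-th derivative of $p$. *)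

(* Defs.v *)
From HB Require Import structures.
From mathcomp Require Import all_boot all_order all_algebra.
From mathcomp Require Import all_classical all_reals all_analysis.
From mathcomp Require Import complex.
Set Implicit Arguments. Unset Strict Implicit. Unset Printing Implicit Defensive.
Import Order.TTheory GRing.Theory Num.Theory.
Local Open Scope ring_scope.

(* Formal power series over a field F, represented by their ORDINARY       *)
(* coefficient sequence: s represents  \sum_k s k * t^k.                   *)
(* (In the paper's convention h(t) = \sum_k c_k t^k/k!, so c_k = k! s_k.)  *)
Section FPS.
Variable F : fieldType.
Definition fps := nat -> F.

Definition fps_one : fps := fun k => (k == 0%N)%:R.
Definition fps_add (s u : fps) : fps := fun k => s k + u k.
Definition fps_sub (s u : fps) : fps := fun k => s k - u k.
Definition fps_scale (c : F) (s : fps) : fps := fun k => c * s k.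
Definition fps_mul (s u : fps) : fps :=
  fun k => \sum_(i < k.+1) s i * u (k - i)%N.
Definition fps_pow (s : fps) (m : nat) : fps := iter m (fps_mul s) fps_one.
Definition fps_exp (a : F) : fps := fun k => a ^+ k / (k`!)%:R.
(* division by t (meaningful for series with zero constant term) *)
Definition fps_divX (s : fps) : fps := fun k => s k.+1.
(* multiplicative inverse of a series with nonzero constant term:
   b_0 = 1/s_0,  b_n = -(1/s_0) \sum_{i=1}^n s_i b_{n-i}. *)
Fixpoint fps_inv_seq (s : fps) (n : nat) : seq F :=
  match n with
  | 0%N => [:: (s 0%N)^-1]
  | n'.+1 => let b := fps_inv_seq s n' in
             rcons b (- (s 0%N)^-1 *
                        \sum_(i < n'.+1) s i.+1 * nth 0 b (n' - i)%N)
  end.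
Definition fps_inv (s : fps) : fps := fun n => nth 0 (fps_inv_seq s n) n.

(* Umbral conventions: h(t) = \sum_k c_k t^k/k! with c_k = k! * s k.       *)
(* h(t) x^m = \sum_{k=0}^m binom(m,k) c_k x^(m-k), extended linearly.      *)
Definition umbral_op (s : fps) (q : {poly F}) : {poly F} :=
  \sum_(m < size q) q`_m *:
     \sum_(k < m.+1) ('C(m, k)%:R * ((k`!)%:R * s k)) *: 'X^(m - k).
(* <h(t) | x^m> = c_m, extended linearly. *)
Definition umbral_pair (s : fps) (q : {poly F}) : F :=
  \sum_(m < size q) ((m`!)%:R * s m) * q`_m.

Definition expm1 (lam : F) : fps := fps_sub (fps_exp lam) fps_one.

(* Bernoulli polynomials: t/(e^t-1) e^(xt) = \sum_n B_n(x) t^n/n!.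
   With b = t/(e^t-1) = inverse of (e^t-1)/t, the coefficient of t^n of the
   product is \sum_k b_k x^(n-k)/(n-k)!. *)
Definition bern_gf : fps := fps_inv (fps_divX (expm1 1)).
Definition bernoulli_poly (n : nat) : {poly F} :=
  (n`!)%:R *: \sum_(k < n.+1) (bern_gf k / ((n - k)`!)%:R) *: 'X^(n - k).

(* Degenerate Bernoulli polynomials.
   (1 + lam t)^(x/lam) = \sum_n (x)_{n,lam} t^n/n!  with
   (x)_{n,lam} = x (x - lam) ... (x - (n-1) lam)  (binomial series), and
   (1 + lam t)^(1/lam) - 1 has coefficients (1)_{n,lam}/n! for n >= 1, 0 for n = 0.
   t/((1+lam t)^(1/lam) - 1) is the inverse of ((1+lam t)^(1/lam) - 1)/t. *)
Definition degfall_poly (lam : F) (n : nat) : {poly F} :=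
  \prod_(i < n) ('X - (i%:R * lam)%:P).
Definition degfall (lam a : F) (n : nat) : F := \prod_(i < n) (a - i%:R * lam).
Definition degexpm1 (lam : F) : fps :=
  fun n => if n == 0%N then 0 else degfall lam 1 n / (n`!)%:R.
Definition degbern_gf (lam : F) : fps := fps_inv (fps_divX (degexpm1 lam)).
Definition degbernoulli_poly (lam : F) (n : nat) : {poly F} :=
  (n`!)%:R *: \sum_(k < n.+1)
      (degbern_gf lam k / ((n - k)`!)%:R) *: degfall_poly lam (n - k).

(* Umbral composition p(lam B(x/lam)) = \sum_i b_i lam^i B_i(x/lam). *)
Definition umbral_bern (lam : F) (p : {poly F}) : {poly F} :=
  \sum_(i < size p) (p`_i * lam ^+ i) *: (bernoulli_poly i \Po (lam^-1 *: 'X)).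

Definition fdiff (a : F) (q : {poly F}) : {poly F} := q \Po ('X + a%:P) - q.

(* Stirling numbers of the second kind via (e^t-1)^m/m! = \sum_l S2(l,m) t^l/l!. *)
Definition stirling2 (l m : nat) : F :=
  (l`!)%:R * ((m`!)%:R^-1 * fps_pow (expm1 1) m l).
End FPS.

Definition cintegral01 (R : realType) (h : R -> R[i]) : R[i] :=
  ((\int[lebesgue_measure]_(u in `[0, 1]) complex.Re (h u)) +i*
   (\int[lebesgue_measure]_(u in `[0, 1]) complex.Im (h u)))%C.

(* Main.v *)
Require Import Defs.
From HB Require Import structures.
From mathcomp Require Import all_boot all_order all_algebra.
From mathcomp Require Import all_classical all_reals all_analysis.
From mathcomp Require Import complex.
From mathcomp Require Import ring.
Import Order.TTheory GRing.Theory Num.Theory.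
Local Open Scope ring_scope.

(* Read as operators with t = d/dx, formal power series compose like they
   multiply, and e^(at) - 1 is the forward difference of step a (Taylor). Since
   (1 + L t)^(x/L) is multiplicative in the exponent x (Vandermonde), the
   generating function of the degenerate Bernoulli polynomials gives
   f(t) beta_k = k beta_(k-1) and Delta beta_(k+1) = (k+1) (x)_(k,L). As
   g f = e^t - 1, it follows that g(t) beta_k = (x)_(k,L), hence
   <g f^j | beta_k> = k! [j = k]. The functionals <g f^j | .> determine a
   polynomial because f has order exactly 1 and g has order 0, so
   a_k = <g f^k | p> / k!. The other expressions for a_k rewrite this pairing. *)

(** * Formal power series and the differential operators they define *)

Section FormalPowerSeries.
Set Implicit Arguments.
Unset Strict Implicit.
Variable F : fieldType.
Implicit Types (s u v : fps F) (q : {poly F}) (c : F).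

(* The Cauchy product agrees with a product of truncations, which transfers
   the ring laws of polynomials to series. *)
Lemma fps_mul_coef N s u k : (k < N)%N ->
  fps_mul s u k = (\poly_(i < N) s i * \poly_(i < N) u i)`_k.
Proof.
move=> kN; rewrite coefM; apply: eq_bigr => -[i /=]; rewrite ltnS => ik _.
by rewrite !coef_poly (leq_ltn_trans ik kN) (leq_ltn_trans (leq_subr _ _) kN).
Qed.

Lemma fps_mulC s u : fps_mul s u = fps_mul u s.
Proof. by apply/funext => k; rewrite !(@fps_mul_coef k.+1)// mulrC. Qed.

Lemma fps_mulA s u v : fps_mul s (fps_mul u v) = fps_mul (fps_mul s u) v.
Proof.
apply/funext => k; pose T w : {poly F} := \poly_(i < k.+1) w i.
transitivity ((T s * (T u * T v))`_k).
  rewrite coefM; apply: eq_bigr => -[i /=]; rewrite ltnS => ik _.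
  by rewrite /T coef_poly ltnS ik (@fps_mul_coef k.+1)// ltnS leq_subr.
rewrite mulrA coefM; apply: eq_bigr => -[i /=]; rewrite ltnS => ik _.
by rewrite /T [X in _ * X]coef_poly ltnS leq_subr (@fps_mul_coef k.+1).
Qed.

Lemma fps_mulCA s u v : fps_mul s (fps_mul u v) = fps_mul u (fps_mul s v).
Proof. by rewrite !fps_mulA (fps_mulC s). Qed.

Lemma fps_mul1 s : fps_mul (fps_one F) s = s.
Proof.
apply/funext => k; rewrite /fps_mul big_ord_recl /fps_one/= mul1r subn0.
by rewrite big1 ?addr0// => i _; rewrite mul0r.
Qed.

Lemma fps_mulBr s u v :
  fps_mul s (fps_sub u v) = fps_sub (fps_mul s u) (fps_mul s v).
Proof.
apply/funext => k; rewrite /fps_mul /fps_sub -sumrB.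
by apply: eq_bigr => i _; rewrite mulrBr.
Qed.

Lemma fps_mulBl s u v :
  fps_mul (fps_sub s u) v = fps_sub (fps_mul s v) (fps_mul u v).
Proof. by rewrite fps_mulC fps_mulBr !(fps_mulC v). Qed.

Lemma fps_mulZl c s u : fps_mul (fps_scale c s) u = fps_scale c (fps_mul s u).
Proof.
apply/funext => k; rewrite /fps_mul /fps_scale mulr_sumr.
by apply: eq_bigr => i _; rewrite mulrA.
Qed.

Lemma fps_mulZr c s u : fps_mul s (fps_scale c u) = fps_scale c (fps_mul s u).
Proof. by rewrite fps_mulC fps_mulZl fps_mulC. Qed.

Lemma fps_scaleA c d s : fps_scale c (fps_scale d s) = fps_scale (c * d) s.
Proof. by apply/funext => k; rewrite /fps_scale mulrA. Qed.

Lemma fps_scale1 s : fps_scale 1 s = s.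
Proof. by apply/funext => k; rewrite /fps_scale mul1r. Qed.

Lemma fps_powZ c s m : fps_pow (fps_scale c s) m = fps_scale (c ^+ m) (fps_pow s m).
Proof.
elim: m => [|m ih]; first by rewrite expr0 fps_scale1.
by rewrite /fps_pow !iterS -!/(fps_pow _ _) ih fps_mulZl fps_mulZr fps_scaleA exprS.
Qed.

Definition fps_X : fps F := fun k => (k == 1%N)%:R.

Lemma fps_mulX s k :
  fps_mul fps_X s k = if k is k'.+1 then s k' else 0.
Proof.
case: k => [|k]; rewrite /fps_mul big_ord_recl /fps_X/= mul0r add0r ?big_ord0//.
by rewrite big_ord_recl/= mul1r subn1 big1 ?addr0// => i _; rewrite mul0r.
Qed.

Lemma fps_divXK s : s 0%N = 0 -> fps_mul fps_X (fps_divX s) = s.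
Proof. by move=> s0; apply/funext => -[|k]; rewrite fps_mulX. Qed.

(** Since [s] is t times [fps_divX s], each factor shifts the coefficients up by one place. *)
Lemma fps_pow_order s m k : s 0%N = 0 -> (k < m)%N -> fps_pow s m k = 0.
Proof.
move=> s0; elim: m k => // m ih k km.
rewrite /fps_pow iterS -/(fps_pow _ _) -(fps_divXK s0) -fps_mulA fps_mulX.
case: k km => // k km; rewrite fps_divXK// /fps_mul big1// => i _.
by rewrite ih ?mulr0// (leq_ltn_trans (leq_subr _ _)).
Qed.

Lemma size_fps_inv_seq s n : size (fps_inv_seq s n) = n.+1.
Proof. by elim: n => //= n ih; rewrite size_rcons ih. Qed.

(** The recursion only appends entries, so earlier ones never change. *)
Lemma nth_fps_inv_seq s n k : (k <= n)%N ->
  nth 0 (fps_inv_seq s n) k = fps_inv s k.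
Proof.
elim: n => [|n ih]; first by rewrite leqn0 => /eqP->.
rewrite leq_eqVlt => /predU1P[->//|]; rewrite ltnS => kn.
by rewrite /= nth_rcons size_fps_inv_seq ltnS kn ih.
Qed.

Lemma fps_invS s n : fps_inv s n.+1 =
  - (s 0%N)^-1 * \sum_(i < n.+1) s i.+1 * fps_inv s (n - i)%N.
Proof.
rewrite {1}/fps_inv /= nth_rcons size_fps_inv_seq ltnn eqxx; congr (_ * _).
by apply: eq_bigr => i _; rewrite nth_fps_inv_seq ?leq_subr.
Qed.

Lemma fps_mulV s : s 0%N != 0 -> fps_mul s (fps_inv s) = fps_one F.
Proof.
move=> s0; apply/funext => -[|n].
  by rewrite /fps_mul big_ord_recl big_ord0 addr0 /= mulfV.
rewrite /fps_mul big_ord_recl /= fps_invS mulrA mulrN mulfV// mulN1r.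
by apply/eqP; rewrite addrC subr_eq0; apply/eqP.
Qed.

(** Recognises an inverse without unfolding its recursion; the constant coefficient of the product
    forces [s 0] to be nonzero. *)
Lemma fps_inv_unique s u : fps_mul s u = fps_one F -> u = fps_inv s.
Proof.
move=> su; have s0 : s 0%N != 0.
  apply/eqP => s0; have := congr1 (fun w : fps F => w 0%N) su.
  rewrite /fps_mul big_ord_recl big_ord0 s0 mul0r addr0 => /esym/eqP.
  by rewrite /fps_one oner_eq0.
by rewrite -[LHS]fps_mul1 -(fps_mulV s0) fps_mulC fps_mulA (fps_mulC u) su fps_mul1.
Qed.

(** Since k! C(m,k) is a falling factorial, the k-th term is a multiple of the k-th derivative of
    X^m. The bound [N] is left free so that several polynomials can share one range of summation. *)
Lemma umbral_opE N s q : (size q <= N)%N ->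
  umbral_op s q = \sum_(k < N) s k *: q^`(k).
Proof.
move=> qN; transitivity
  (\sum_(m < size q) q`_m *: \sum_(k < N) s k *: ('X^m)^`(k) : {poly F}).
  apply: eq_bigr => -[m /= mq] _; congr (_ *: _).
  (* Terms with k > m differentiate X^m to zero. *)
  rewrite [RHS](bigID (fun k : 'I_N => (k < m.+1)%N))/=.
  rewrite (big_ord_widen N (fun k =>
     ('C(m, k)%:R * ((k`!)%:R * s k)) *: 'X^(m - k)) (leq_trans mq qN)).
  rewrite -[LHS]addr0; congr (_ + _).
    apply: eq_bigr => k _; rewrite derivnXn mulrA -natrM bin_ffact.
    by rewrite -scaler_nat scalerA mulrC.
  rewrite big1// => k; rewrite -leqNgt => mk.
  by rewrite derivn_poly0 ?scaler0// size_polyXn.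
rewrite (eq_bigr (fun m : 'I_(size q) =>
  \sum_(k < N) s k *: (q`_m *: ('X^m)^`(k)))); last first.
  move=> m _; rewrite scaler_sumr; apply: eq_bigr => k _.
  by rewrite !scalerA mulrC.
rewrite exchange_big; apply: eq_bigr => k _; rewrite -scaler_sumr.
congr (_ *: _); rewrite -[in RHS](coefK q) poly_def linear_sum.
by apply: eq_bigr => m _; rewrite linearZ.
Qed.

Lemma umbral_op_linear s (c : F) q r :
  umbral_op s (c *: q + r) = c *: umbral_op s q + umbral_op s r.
Proof.
pose N := maxn (size q) (size r).
have qN : (size q <= N)%N by rewrite leq_maxl.
have rN : (size r <= N)%N by rewrite leq_maxr.
have cqrN : (size (c *: q + r)%R <= N)%N.
  by rewrite (leq_trans (size_polyD _ _))// geq_max rN (leq_trans (size_scale_leq _ _)).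
rewrite !(@umbral_opE N)// scaler_sumr -big_split /=.
by apply: eq_bigr => k _; rewrite linearP scalerDr !scalerA (mulrC c).
Qed.
HB.instance Definition _ s :=
  GRing.isLinear.Build F {poly F} {poly F} *:%R (umbral_op s) (umbral_op_linear s).

Lemma umbral_op_scale c s q : umbral_op (fps_scale c s) q = c *: umbral_op s q.
Proof.
rewrite !(@umbral_opE (size q))// scaler_sumr.
by apply: eq_bigr => k _; rewrite scalerA.
Qed.

Lemma umbral_op1 q : umbral_op (fps_one F) q = q.
Proof.
rewrite (@umbral_opE (size q).+1)// big_ord_recl scale1r derivn0 big1 ?addr0//.
by move=> i _; rewrite /fps_one/= scale0r.
Qed.

Lemma umbral_opX q : umbral_op fps_X q = q^`().
Proof.
rewrite (@umbral_opE (size q).+2) ?leqW// !big_ord_recl /fps_X/=.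
by rewrite scale0r scale1r add0r big1 ?addr0// => i _; rewrite scale0r.
Qed.

Lemma size_umbral_op s q : (size (umbral_op s q) <= size q)%N.
Proof.
rewrite (@umbral_opE (size q))//; apply/leq_sizeP => j qj.
rewrite coef_sum big1// => k _; rewrite coefZ coef_derivn nth_default ?mul0rn ?mulr0//.
exact: leq_trans qj (leq_addl _ _).
Qed.

(** With D = d/dx, both sides collect the terms s_i u_j D^(i+j) q, which vanish once i + j reaches
    [size q]. *)
Lemma umbral_op_mul s u q :
  umbral_op (fps_mul s u) q = umbral_op s (umbral_op u q).
Proof.
pose N := size q; pose G i k : {poly F} := (s i * u (k - i)%N) *: q^`(k).
rewrite [RHS](@umbral_opE N) ?size_umbral_op// (@umbral_opE N u)//.
rewrite (@umbral_opE N (fps_mul s u))//.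
transitivity (\sum_(k < N) \sum_(i < N | (i <= k)%N) G i k).
  apply: eq_bigr => -[k /= kN] _; rewrite scaler_suml.
  by rewrite (big_ord_widen N (fun i => G i k)).
rewrite (exchange_big_dep predT)//=; apply: eq_bigr => -[i /= iN] _.
rewrite linear_sum scaler_sumr /=.
transitivity (\sum_(i <= k < N) G i k).
  by rewrite big_geq_mkord.
(* The added terms are zero, and the longer range becomes j < N after the substitution k = j + i. *)
transitivity (\sum_(i <= k < N + i) G i k).
  rewrite [RHS](@big_cat_nat _ _ _ N) ?leq_addr ?(ltnW iN)//=.
  rewrite [X in _ + X]big_nat_cond [X in _ + X]big1 ?addr0// => k /andP[/andP[Nk _] _].
  by rewrite /G derivn_poly0 ?scaler0.
rewrite -{1}(add0n i) big_addn addnK big_mkord; apply: eq_bigr => j _.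
have qji : q^`(j + i) = (q^`(j))^`(i) by rewrite /derivn addnC iterD.
by rewrite /G addnK qji linearZ scalerA.
Qed.

Lemma umbral_op_comm s u q :
  umbral_op s (umbral_op u q) = umbral_op u (umbral_op s q).
Proof. by rewrite -!umbral_op_mul fps_mulC. Qed.

Lemma umbral_op_pow s m q : umbral_op (fps_pow s m) q = iter m (umbral_op s) q.
Proof.
elim: m => [|m ih]; first exact: umbral_op1.
by rewrite iterS -ih -umbral_op_mul.
Qed.

Lemma umbral_op0 s q : (umbral_op s q).[0] = umbral_pair s q.
Proof.
rewrite (@umbral_opE (size q))// horner_sum; apply: eq_bigr => m _.
by rewrite hornerZ horner_coef0 coef_derivn addn0 ffactnn mulrnAr -mulrA mulr_natl.
Qed.

Lemma umbral_opC s c : umbral_op s c%:P = (s 0%N * c)%:P.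
Proof.
rewrite (@umbral_opE 1) ?size_polyC ?leq_b1// big_ord_recl big_ord0 addr0.
by rewrite derivn0 -mul_polyC polyCM.
Qed.

Lemma fdiffE (a : F) q x : (fdiff a q).[x] = q.[x + a] - q.[x].
Proof. by rewrite /fdiff hornerD hornerN horner_comp !hornerE. Qed.

End FormalPowerSeries.

(** * Degenerate exponentials and differences of degenerate Bernoulli polynomials *)

Section DegenerateBernoulli.
Set Implicit Arguments.
Unset Strict Implicit.
Variable F : numFieldType.
Implicit Types (s u : fps F) (q : {poly F}) (a x y L : F).

Lemma natr_fact_neq0 n : (n`!)%:R != 0 :> F.
Proof. by rewrite pnatr_eq0 -lt0n fact_gt0. Qed.

(** In characteristic 0 the points 0, 1, 2, ... are distinct and supply more roots of the difference
    than its degree allows. *)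
Lemma poly_ext q r : (forall x : F, q.[x] = r.[x]) -> q = r.
Proof.
move=> qr; apply/eqP; rewrite -subr_eq0; apply/eqP; set d := q - r.
pose rs : seq F := [seq i%:R | i <- iota 0 (size d)].
apply: (@roots_geq_poly_eq0 _ d rs).
- by apply/allP => x _; rewrite rootE hornerD hornerN qr subrr.
- by rewrite map_inj_uniq ?iota_uniq// => i j /eqP; rewrite eqr_nat => /eqP.
- by rewrite size_map size_iota.
Qed.

Lemma umbral_op_sub s u q :
  umbral_op (fps_sub s u) q = umbral_op s q - umbral_op u q.
Proof.
rewrite !(@umbral_opE _ (size q))// -sumrB.
by apply: eq_bigr => k _; rewrite scalerBl.
Qed.

(** Taylor's formula at x. *)
Lemma horner_umbral_op_exp a q x : (umbral_op (fps_exp a) q).[x] = q.[x + a].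
Proof.
rewrite nderiv_taylor; last exact: mulrC.
rewrite (@umbral_opE _ (size q))// horner_sum; apply: eq_bigr => k _.
rewrite hornerZ nderivn_def hornerMn -mulr_natr /fps_exp.
by rewrite mulrC -mulrA [(k`!)%:R * _]mulrCA mulfV ?mulr1// natr_fact_neq0.
Qed.

Lemma umbral_op_expm1 a q : umbral_op (expm1 a) q = fdiff a q.
Proof.
apply: poly_ext => x; rewrite umbral_op_sub umbral_op1 fdiffE hornerD hornerN.
by rewrite horner_umbral_op_exp.
Qed.

Lemma expm1_0 a : expm1 a 0%N = 0.
Proof. by rewrite /expm1 /fps_sub /fps_exp /fps_one expr0 divr1 subrr. Qed.

Lemma expm1S a n : expm1 a n.+1 = a ^+ n.+1 / (n.+1`!)%:R.
Proof. by rewrite /expm1 /fps_sub /fps_exp /fps_one subr0. Qed.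

(* The series (1 + L t)^(x/L), multiplicative in the exponent x. *)
Definition degexp L x : fps F := fun m => degfall L x m / (m`!)%:R.

Lemma degfallS L x n : degfall L x n.+1 = (x - n%:R * L) * degfall L x n.
Proof. by rewrite /degfall big_ord_recr /= [LHS]mulrC. Qed.

(** Coefficient form of (1 + L t) y' = x y, the differential equation of y = (1 + L t)^(x/L). *)
Lemma degexpS L x n :
  n.+1%:R * degexp L x n.+1 = (x - n%:R * L) * degexp L x n.
Proof.
rewrite /degexp degfallS factS natrM mulrA -mulf_div divff ?pnatr_eq0//.
by rewrite mul1r mulrA.
Qed.

Lemma degexp0 L x : degexp L x 0 = 1.
Proof. by rewrite /degexp /degfall big_ord0 divr1. Qed.

Lemma degexpD L x y : fps_mul (degexp L x) (degexp L y) = degexp L (x + y).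
Proof.
apply/funext; elim=> [|n ih].
  by rewrite /fps_mul big_ord_recl big_ord0 addr0 !degexp0 mulr1.
have n1 : n.+1%:R != 0 :> F by rewrite pnatr_eq0.
apply: (mulfI n1); rewrite degexpS -ih /fps_mul.
pose G i j := degexp L x i * degexp L y j.
(* Leibniz rule: the weight n + 1 is split as i + (n + 1 - i), and each part lowers one of the two
   indices through [degexpS]. *)
transitivity (\sum_(i < n.+2) i%:R * G i (n.+1 - i)%N +
              \sum_(i < n.+2) (n.+1 - i)%:R * G i (n.+1 - i)%N).
  rewrite mulr_sumr -big_split; apply: eq_bigr => i _ /=.
  by rewrite -mulrDl -natrD subnKC// -ltnS.
rewrite big_ord_recl mul0r add0r [X in _ + X]big_ord_recr /= subnn mul0r addr0.
rewrite -big_split mulr_sumr; apply: eq_bigr => -[i /=]; rewrite ltnS => le_in _.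
rewrite /bump /= add1n subSS subSn// /G [i.+1%:R * _]mulrA degexpS.
rewrite [(n - i).+1%:R * _]mulrCA degexpS natrB//.
ring.
Qed.

Lemma degexpm1E L : degexpm1 L = fps_sub (degexp L 1) (fps_one F).
Proof.
apply/funext => -[|n]; rewrite /degexpm1 /fps_sub /fps_one/= ?degexp0 ?subrr//.
by rewrite subr0.
Qed.

(** At exponent x = L the series is the polynomial 1 + L t: from degree 2 on, the falling factorial
    contains the factor L - L. *)
Lemma degexp_step L : fps_sub (degexp L L) (fps_one F) = fps_scale L (fps_X F).
Proof.
have fall n : degfall L L n.+2 = 0.
  elim: n => [|n ih]; last by rewrite degfallS ih mulr0.
  by rewrite !degfallS mul1r subrr mul0r.
apply/funext => -[|[|n]]; rewrite /fps_sub /fps_one /fps_scale /fps_X /=.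
- by rewrite degexp0 subrr mulr0.
- by rewrite /degexp degfallS /degfall big_ord0 mul0r !subr0 divr1.
- by rewrite /degexp fall mul0r subr0 mulr0.
Qed.

Lemma degbern_gfP L : fps_mul (degbern_gf L) (degexpm1 L) = fps_X F.
Proof.
have {1}-> : degexpm1 L = fps_mul (fps_X F) (fps_divX (degexpm1 L)).
  by rewrite fps_divXK.
rewrite fps_mulCA (fps_mulC (degbern_gf L)) fps_mulV.
  by rewrite fps_mulC fps_mul1.
by rewrite /fps_divX /degexpm1 /degfall big_ord1 mul0r subr0 divr1 oner_eq0.
Qed.

Lemma horner_degfall_poly L n x : (degfall_poly L n).[x] = degfall L x n.
Proof. by rewrite horner_prod; apply: eq_bigr => i _; rewrite hornerXsubC. Qed.

Lemma horner_degbernoulli_poly L n x : (degbernoulli_poly L n).[x] =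
  (n`!)%:R * fps_mul (degbern_gf L) (degexp L x) n.
Proof.
rewrite hornerZ horner_sum; congr (_ * _); apply: eq_bigr => k _.
by rewrite hornerZ horner_degfall_poly /degexp mulrAC mulrA.
Qed.

Lemma size_degbernoulli_poly L n : (size (degbernoulli_poly L n) <= n.+1)%N.
Proof.
apply: (leq_trans (size_scale_leq _ _)); apply: (leq_trans (size_sum _ _ _)).
apply/bigmax_leqP => k _; apply: (leq_trans (size_scale_leq _ _)).
rewrite /degfall_poly -(big_mkord xpredT (fun i => 'X - (i%:R * L)%:P)).
by rewrite size_prod_XsubC size_iota subn0 ltnS leq_subr.
Qed.

(** Shifting x by a multiplies (1 + L t)^(x/L) by (1 + L t)^(a/L), so the difference only changes
    the factor in front of it. *)
Lemma horner_fdiff_degbernoulli_poly a L n x :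
  (fdiff a (degbernoulli_poly L n)).[x] =
  (n`!)%:R * fps_mul (fps_mul (degbern_gf L)
               (fps_sub (degexp L a) (fps_one F))) (degexp L x) n.
Proof.
rewrite fdiffE !horner_degbernoulli_poly -mulrBr -fps_mulA fps_mulBl degexpD.
by rewrite fps_mul1 fps_mulBr (addrC a).
Qed.

(** For step 1 the new factor cancels the denominator (1 + L t)^(1/L) - 1 and leaves t, which lowers
    the index by one. *)
Lemma fdiff1_degbernoulli_poly L n :
  fdiff 1 (degbernoulli_poly L n.+1) = n.+1%:R *: degfall_poly L n.
Proof.
apply: poly_ext => x; rewrite horner_fdiff_degbernoulli_poly -degexpm1E degbern_gfP.
rewrite fps_mulX hornerZ horner_degfall_poly /degexp factS natrM.
by rewrite -mulrA [(n`!)%:R * _]mulrCA mulfV ?mulr1// natr_fact_neq0.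
Qed.

(** For step L the new factor is L t. At n = 0 both sides are zero, so the truncated index [n.-1] is
    harmless. *)
Lemma fdiff_degbernoulli_poly L n :
  fdiff L (degbernoulli_poly L n) = (n%:R * L) *: degbernoulli_poly L n.-1.
Proof.
apply: poly_ext => x; rewrite horner_fdiff_degbernoulli_poly degexp_step.
rewrite fps_mulZr fps_mulZl (fps_mulC _ (fps_X F)) -fps_mulA.
rewrite /fps_scale fps_mulX hornerZ horner_degbernoulli_poly.
case: n => [|n]; first by rewrite mulr0 mulr0 !mul0r.
by rewrite /= factS natrM; ring.
Qed.

End DegenerateBernoulli.

(** * Biorthogonality and expansion in degenerate Bernoulli polynomials *)

Section Expansion.
Set Implicit Arguments.
Unset Strict Implicit.
Variable F : numFieldType.
Variable L : F.
Hypothesis L0 : L != 0.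
Implicit Types (s u : fps F) (p q : {poly F}).

(* The degenerate Bernoulli polynomials are Sheffer for the pair (g, f). *)
Definition sheffer_g : fps F :=
  fps_scale L (fps_mul (fps_divX (expm1 1)) (fps_inv (fps_divX (expm1 L)))).
Definition sheffer_f : fps F := fps_scale L^-1 (expm1 L).

Lemma divX_expm1_neq0 a : a != 0 -> fps_divX (expm1 a) 0%N != 0 :> F.
Proof. by move=> a0; rewrite /fps_divX expm1S divr1. Qed.

(** Up to the scalar 1/L, [sheffer_f] is t times (e^(Lt) - 1)/t, and this quotient cancels against
    the inverse in [sheffer_g]. *)
Lemma sheffer_mul_gf : fps_mul sheffer_g sheffer_f = expm1 1.
Proof.
rewrite /sheffer_f -{1}(fps_divXK (expm1_0 L)) fps_mulZl !fps_mulZr fps_scaleA.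
rewrite mulfV// fps_scale1 -fps_mulA (fps_mulCA _ (fps_X F)).
rewrite (fps_mulC (fps_inv _)) fps_mulV ?divX_expm1_neq0//.
by rewrite (fps_mulC (fps_X F)) fps_mul1 fps_mulC fps_divXK ?expm1_0.
Qed.

Lemma umbral_op_sheffer_f q : umbral_op sheffer_f q = L^-1 *: fdiff L q.
Proof. by rewrite umbral_op_scale umbral_op_expm1. Qed.

Lemma sheffer_f_degbernoulli_poly n :
  umbral_op sheffer_f (degbernoulli_poly L n) = n%:R *: degbernoulli_poly L n.-1.
Proof.
by rewrite umbral_op_sheffer_f fdiff_degbernoulli_poly scalerA mulrCA mulVf ?mulr1.
Qed.

Lemma iter_sheffer_f_degbernoulli_poly k n :
  iter k (umbral_op sheffer_f) (degbernoulli_poly L n) =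
  (n ^_ k)%:R *: degbernoulli_poly L (n - k).
Proof.
elim: k => [|k ih]; first by rewrite ffactn0 scale1r subn0.
rewrite iterS ih linearZ /= sheffer_f_degbernoulli_poly scalerA.
by rewrite ffactnSr natrM subnS.
Qed.

(** Instead of expanding g, apply g f = e^t - 1 to beta_(n+1): this gives (n+1) g beta_n on one side
    and Delta beta_(n+1) on the other. *)
Lemma sheffer_g_degbernoulli_poly n :
  umbral_op sheffer_g (degbernoulli_poly L n) = degfall_poly L n.
Proof.
have n1 : n.+1%:R != 0 :> F by rewrite pnatr_eq0.
apply: (scalerI n1); rewrite -fdiff1_degbernoulli_poly -umbral_op_expm1.
rewrite -sheffer_mul_gf umbral_op_mul sheffer_f_degbernoulli_poly.
by rewrite [RHS]linearZ.
Qed.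

(** The functional <g f^k | p> / k!, kept as an operator value at 0 so that f can be applied step by
    step. *)
Definition sheffer_coef k p : F :=
  (k`!)%:R^-1 * (umbral_op sheffer_g (iter k (umbral_op sheffer_f) p)).[0].

Lemma sheffer_coef_linear k c p q :
  sheffer_coef k (c *: p + q) = c * sheffer_coef k p + sheffer_coef k q.
Proof.
rewrite /sheffer_coef -!umbral_op_pow !linearP /= hornerD hornerZ.
by rewrite mulrDr mulrCA.
Qed.
HB.instance Definition _ k :=
  GRing.isLinear.Build F {poly F} F *%R (sheffer_coef k) (@sheffer_coef_linear k).

Lemma sheffer_coef_degbernoulli_poly k n :
  sheffer_coef k (degbernoulli_poly L n) = (k == n)%:R.
Proof.
rewrite /sheffer_coef iter_sheffer_f_degbernoulli_poly linearZ hornerZ.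
rewrite /= sheffer_g_degbernoulli_poly horner_degfall_poly.
have [kn|nk|->] := ltngtP k n; last 2 first.
- by rewrite ffact_small// mul0r mulr0.
- by rewrite ffactnn subnn /degfall big_ord0 mulr1 mulVf// natr_fact_neq0.
(* For k < n the first factor of (x)_(n-k,L) is x, which vanishes at 0. *)
by rewrite -(subnSK kn) /degfall big_ord_recl mul0r subrr mul0r !mulr0.
Qed.

(** The inverse of (e^(Lt) - 1)/t recovers d/dx from e^(Lt) - 1, so a polynomial killed by the
    difference has derivative zero. *)
Lemma size1_of_sheffer_f q : umbral_op sheffer_f q = 0 -> q = (q`_0)%:P.
Proof.
rewrite umbral_op_scale => /eqP; rewrite scaler_eq0 invr_eq0 (negPf L0) /= => /eqP Lq.
have dq : q^`() = 0.
  rewrite -umbral_opX -[LHS]umbral_op1 -(fps_mulV (divX_expm1_neq0 L0)).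
  rewrite fps_mulC umbral_op_mul -[umbral_op (fps_divX _) _]umbral_op_mul.
  by rewrite fps_mulC fps_divXK ?expm1_0// Lq linear0.
apply/polyP => -[|i]; rewrite coefC//=.
have /eqP := coef_deriv q i; rewrite dq coef0 eq_sym mulrn_eq0 /=.
by move=> /eqP.
Qed.

(** Induction on the size: up to nonzero factors, the functionals of f q are those of q with index
    raised by one. Hence f q = 0 and q is constant, and <g | q> = 0 kills it since g has a nonzero
    constant term. *)
Lemma sheffer_coef_inj n q : (size q <= n)%N ->
  (forall k, (k < n)%N -> sheffer_coef k q = 0) -> q = 0.
Proof.
elim: n q => [|n ih] q; first by rewrite leqn0 size_poly_eq0 => /eqP.
move=> qn q0.
have fq0 : umbral_op sheffer_f q = 0.
  apply: ih.
    (* As f has no constant term, every surviving summand differentiates at least once and the size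
       drops. *)
    apply/leq_sizeP => j nj; rewrite (umbral_opE _ qn) coef_sum big1// => -[[|k] kn] _.
      by rewrite /= /sheffer_f /fps_scale expm1_0 mulr0 scale0r coef0.
    rewrite coefZ coef_derivn nth_default ?mul0rn ?mulr0//.
    by rewrite (leq_trans qn)// addSn ltnS (leq_trans nj)// leq_addl.
  move=> k kn; have /eqP := q0 k.+1 kn; rewrite /sheffer_coef mulf_eq0.
  rewrite invr_eq0 (negPf (natr_fact_neq0 F _)) /= => /eqP.
  by rewrite -iterS iterSr => ->; rewrite mulr0.
have := q0 0%N isT; rewrite /sheffer_coef /= (size1_of_sheffer_f fq0).
rewrite umbral_opC hornerC fact0 invr1 mul1r => /eqP; rewrite mulf_eq0.
rewrite /sheffer_g /fps_scale /fps_mul big_ord1 !mulf_eq0 (negPf L0).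
rewrite (negPf (divX_expm1_neq0 (oner_neq0 F))) /= invr_eq0.
by rewrite (negPf (divX_expm1_neq0 L0)) => /eqP ->.
Qed.

Lemma degbernoulli_expansion n p : (size p <= n)%N ->
  p = \sum_(k < n) sheffer_coef k p *: degbernoulli_poly L k.
Proof.
move=> pn; apply/eqP; rewrite -subr_eq0; apply/eqP; apply: (@sheffer_coef_inj n).
  rewrite (leq_trans (size_polyD _ _))// geq_max pn size_polyN.
  apply: (leq_trans (size_sum _ _ _)); apply/bigmax_leqP => k _.
  apply: (leq_trans (size_scale_leq _ _)).
  exact: (leq_trans (size_degbernoulli_poly _ _)).
move=> k kn; rewrite linearB linear_sum (bigD1 (Ordinal kn))//= big1.
  by rewrite addr0 linearZ /= sheffer_coef_degbernoulli_poly eqxx mulr1 subrr.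
move=> i ik; rewrite linearZ /= sheffer_coef_degbernoulli_poly.
by rewrite (negPf (_ : k != i)) ?mulr0// eq_sym.
Qed.

(** One factor f merges with g: g f^(k+1) = f^k (e^t - 1). *)
Lemma sheffer_coefS k p : sheffer_coef k.+1 p =
  (k.+1`!)%:R^-1 * (umbral_op (fps_pow sheffer_f k) (fdiff 1 p)).[0].
Proof.
rewrite /sheffer_coef -umbral_op_expm1 -sheffer_mul_gf umbral_op_mul.
by rewrite umbral_op_comm umbral_op_pow iterSr.
Qed.

Lemma horner_iter_fdiff m q x : (iter m (fdiff L) q).[x] =
  \sum_(j < m.+1) ('C(m, j)%:R * (-1) ^+ (m - j)) * q.[x + j%:R * L].
Proof.
elim: m x => [|m ih] x.
  by rewrite big_ord_recl big_ord0 mul0r !addr0 expr0 !mul1r.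
rewrite iterS fdiffE !ih; pose T j := q.[x + j%:R * L].
(* Pascal's rule on C(m+1, j+1), with the term j = 0 set apart. *)
transitivity
  (\sum_(j < m.+1) ('C(m, j)%:R * (-1) ^+ (m - j)) * T j.+1 +
   ((-1) ^+ m.+1 * T 0%N +
     \sum_(j < m.+1) ('C(m, j.+1)%:R * (-1) ^+ (m - j)) * T j.+1)); last first.
  rewrite [RHS]big_ord_recl bin0 mul1r subn0 addrCA -big_split; congr (_ + _).
  by apply: eq_bigr => j _; rewrite /= /bump /= add1n subSS binS natrD !mulrDl addrC.
congr (_ + _).
  by apply: eq_bigr => j _; rewrite /T -natr1 mulrDl mul1r addrA addrAC.
rewrite [X in _ + X]big_ord_recr /= bin_small// !mul0r addr0.
rewrite [X in - X]big_ord_recl bin0 mul1r subn0 opprD exprS mulN1r mulNr.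
congr (_ + _); rewrite -sumrN; apply: eq_bigr => -[j jm] _ /=.
by rewrite /bump /= add1n -[in RHS](subnSK jm) exprS mulN1r mulrN mulNr.
Qed.

Lemma derivn_comp_XaddC q c l :
  (q \Po ('X + c%:P))^`(l) = q^`(l) \Po ('X + c%:P).
Proof.
elim: l => // l ih; rewrite !derivnS ih deriv_comp derivD derivX derivC.
by rewrite addr0 mulr1.
Qed.

Lemma horner0_derivn_fdiff1 p l :
  ((fdiff 1 p)^`(l)).[0] = (p^`(l)).[1] - (p^`(l)).[0].
Proof. by rewrite linearB /= derivn_comp_XaddC hornerD hornerN horner_comp !hornerE. Qed.

End Expansion.

(** * Rescaling of the variable and closed forms of the coefficients *)

Section Dilation.
Set Implicit Arguments.
Unset Strict Implicit.
Variable F : numFieldType.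
Variable L : F.
Implicit Types (s u : fps F) (p q : {poly F}).

(** The series s(L t). *)
Definition fps_dil s : fps F := fun k => L ^+ k * s k.

Lemma fps_dil_mul s u : fps_dil (fps_mul s u) = fps_mul (fps_dil s) (fps_dil u).
Proof.
apply/funext => k; rewrite /fps_dil /fps_mul mulr_sumr; apply: eq_bigr => i _.
by rewrite mulrACA -exprD subnKC// -ltnS.
Qed.

Lemma fps_dil_one : fps_dil (fps_one F) = fps_one F.
Proof. by apply/funext => -[|k]; rewrite /fps_dil /fps_one/= ?mul1r ?mulr0. Qed.

Lemma fps_dil_pow s m : fps_dil (fps_pow s m) = fps_pow (fps_dil s) m.
Proof.
elim: m => [|m ih]; first exact: fps_dil_one.
by rewrite /fps_pow !iterS fps_dil_mul -!/(fps_pow _ _) ih.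
Qed.

Lemma fps_dil_expm1 : fps_dil (expm1 1) = expm1 L.
Proof.
apply/funext => -[|k]; first by rewrite /fps_dil !expm1_0 mulr0.
by rewrite /fps_dil !expm1S expr1n mulrA mulr1.
Qed.

Lemma fps_dil_bern_gf : L != 0 ->
  fps_dil (bern_gf F) = fps_inv (fps_scale L^-1 (fps_divX (expm1 L))).
Proof.
move=> L0; apply: fps_inv_unique.
have -> : fps_scale L^-1 (fps_divX (expm1 L)) = fps_dil (fps_divX (expm1 1)).
  apply/funext => k; rewrite -fps_dil_expm1 /fps_scale /fps_divX /fps_dil.
  by rewrite exprS !mulrA mulVf// mul1r.
by rewrite -fps_dil_mul fps_mulV ?fps_dil_one// divX_expm1_neq0 ?oner_neq0.
Qed.

(** In L^m B_m(x/L) the term in x^(m-k) carries L^m / L^(m-k) = L^k, which is the weight that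
    [fps_dil] puts on coefficient k. *)
Lemma umbral_bernE p : L != 0 ->
  umbral_bern L p = umbral_op (fps_dil (bern_gf F)) p.
Proof.
move=> L0; apply: eq_bigr => -[m /= _] _; rewrite -scalerA; congr (_ *: _).
rewrite /bernoulli_poly linearZ linear_sum /= scalerA scaler_sumr.
apply: eq_bigr => -[k /=]; rewrite ltnS => km _.
rewrite linearZ /= comp_Xn_poly exprZn !scalerA; congr (_ *: _).
rewrite /fps_dil -(bin_fact km) !natrM -[in LHS](subnKC km) exprD exprVn.
have := natr_fact_neq0 F (m - k); have : L ^+ (m - k) != 0 by rewrite expf_neq0.
rewrite subnKC// => ? ?; field; exact/andP.
Qed.

Lemma horner_sheffer_coef0 p : sheffer_coef L 0 p = (umbral_op (sheffer_g L) p).[0].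
Proof. by rewrite /sheffer_coef fact0 invr1 mul1r. Qed.

(** Absorbing L into the inverse regroups g as (e^t - 1)/t times L t/(e^(Lt) - 1). *)
Lemma sheffer_coef0_pair p : L != 0 ->
  sheffer_coef L 0 p = umbral_pair (fps_divX (expm1 1))
    (umbral_op (fps_inv (fps_scale L^-1 (fps_divX (expm1 L)))) p).
Proof.
move=> L0; rewrite horner_sheffer_coef0 -umbral_op0 -umbral_op_mul.
congr (umbral_op _ p).[0]; rewrite /sheffer_g -fps_mulZr; congr fps_mul.
apply: fps_inv_unique; rewrite fps_mulZl fps_mulZr fps_scaleA mulVf//.
by rewrite fps_scale1 fps_mulV// divX_expm1_neq0.
Qed.

Lemma sheffer_coef0_bern p : L != 0 ->
  sheffer_coef L 0 p = umbral_pair (fps_divX (expm1 1)) (umbral_bern L p).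
Proof.
by move=> L0; rewrite sheffer_coef0_pair// umbral_bernE// fps_dil_bern_gf.
Qed.

Lemma sheffer_coefS_op k p : L != 0 ->
  sheffer_coef L k.+1 p = ((k.+1`!)%:R * L ^+ k)^-1 *
    (umbral_op (fps_pow (expm1 L) k) (fdiff 1 p)).[0].
Proof.
move=> L0; rewrite sheffer_coefS// fps_powZ umbral_op_scale hornerZ exprVn.
by rewrite invfM mulrA.
Qed.

Lemma sheffer_coefS_iter k p : L != 0 ->
  sheffer_coef L k.+1 p =
  ((k.+1`!)%:R * L ^+ k)^-1 * (iter k (fdiff L) (fdiff 1 p)).[0].
Proof.
move=> L0; rewrite sheffer_coefS_op// umbral_op_pow; congr (_ * _.[0]).
by apply: eq_iter => q; exact: umbral_op_expm1.
Qed.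

Lemma sheffer_coefS_sum k p : L != 0 ->
  sheffer_coef L k.+1 p = ((k.+1`!)%:R * L ^+ k)^-1 *
    \sum_(j < k.+1) ('C(k, j)%:R * (-1) ^+ (k - j) *
       (p.[1 + j%:R * L] - p.[j%:R * L])).
Proof.
move=> L0; rewrite sheffer_coefS_iter// horner_iter_fdiff; congr (_ * _).
by apply: eq_bigr => j _; rewrite fdiffE add0r [1 + _]addrC.
Qed.

(** The coefficients of (e^(Lt) - 1)^k are L^l times those of (e^t - 1)^k, which are Stirling
    numbers up to factorials; those with l < k vanish. *)
Lemma sheffer_coefS_stirling k n p : L != 0 -> (size p <= n)%N ->
  sheffer_coef L k.+1 p = (k.+1%:R)^-1 *
    \sum_(k <= l < n) (stirling2 F l k * (L ^+ (l - k) / (l`!)%:R) *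
       ((p^`(l)).[1] - (p^`(l)).[0])).
Proof.
move=> L0 pn; rewrite sheffer_coefS_op// (@umbral_opE _ n); last first.
  by rewrite -umbral_op_expm1 (leq_trans (size_umbral_op _ _)).
rewrite horner_sum !mulr_sumr big_geq_mkord /=.
have powE l : L ^+ l * fps_pow (expm1 1) k l = fps_pow (expm1 L) k l.
  by rewrite -fps_dil_expm1 -fps_dil_pow.
rewrite (bigID (fun l : 'I_n => (k <= l)%N)) /= addrC big1 ?add0r.
  apply: eq_bigr => l kl; rewrite hornerZ horner0_derivn_fdiff1 -powE.
  rewrite mulrA [RHS]mulrA; congr (_ * _).
  rewrite /stirling2 factS natrM -{1}(subnKC kl) exprD.
  have := natr_fact_neq0 F l; have := natr_fact_neq0 F k.
  have Lk : L ^+ k != 0 by rewrite expf_neq0.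
  have kR : k.+1%:R != 0 :> F by rewrite pnatr_eq0.
  move: (k.+1%:R) kR => k1 ? ? ?; field.
  exact/and4P.
move=> l; rewrite -ltnNge => lk.
by rewrite (fps_pow_order (expm1_0 L) lk) scale0r horner0 mulr0.
Qed.

End Dilation.

(** * Integration over the unit interval *)

Section UnitIntervalIntegral.
Import numFieldNormedType.Exports.
Variable R : realType.

Lemma integral01_poly (N : nat) (c : nat -> R) :
  \int[lebesgue_measure]_(u in `[0, 1]) (\sum_(m < N) c m * u ^+ m) =
  \sum_(m < N) c m / m.+1%:R.
Proof.
(* An antiderivative; at i = 0 division by zero gives 0, so [P] vanishes at 0. *)
pose P : {poly R} := \poly_(i < N.+1) (c i.-1 / i%:R).
have dP : P^`() = \poly_(i < N) c i.
  apply/polyP => i; rewrite coef_deriv !coef_poly ltnS /=.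
  case: ifP => _; last by rewrite mul0rn.
  by rewrite -[_ *+ i.+1]mulr_natr divfK// pnatr_eq0.
under eq_Rintegral do rewrite -horner_poly.
rewrite /Rintegral (@continuous_FTC2 _ _ (horner P))//=.
- rewrite horner_coef0 coef_poly /= invr0 mulr0 subr0.
  rewrite horner_poly big_ord_recl /= invr0 mulr0 mul0r add0r.
  by apply: eq_bigr => i _; rewrite expr1n mulr1.
- by apply: continuous_subspaceT; exact: continuous_horner.
- split.
  + by move=> x _; exact: derivable_horner.
  + by apply: cvg_at_right_filter; exact: continuous_horner.
  + by apply: cvg_at_left_filter; exact: continuous_horner.
- by move=> x _; rewrite -derivE dP.
Qed.

Implicit Types (z : R[i]) (c : R).

Lemma Re_mul_real z c : complex.Re (z * (c%:C)%C) = complex.Re z * c.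
Proof. by case: z => x y /=; rewrite mulr0 subr0. Qed.

Lemma Im_mul_real z c : complex.Im (z * (c%:C)%C) = complex.Im z * c.
Proof. by case: z => x y /=; rewrite mulr0 add0r. Qed.

(** The functional (e^t - 1)/t sends x^m to 1/(m+1), the integral of u^m over [0,1]; real and
    imaginary parts are compared separately. *)
Lemma cintegral01_horner (q : {poly R[i]}) :
  cintegral01 (fun u : R => q.[(u%:C)%C]) = umbral_pair (fps_divX (expm1 1)) q.
Proof.
have -> : umbral_pair (fps_divX (expm1 1)) q =
    \sum_(m < size q) q`_m * ((m.+1%:R^-1)%:C)%C.
  apply: eq_bigr => m _; rewrite /fps_divX expm1S expr1n factS natrM.
  rewrite mulrC rmorphV ?unitfE ?pnatr_eq0// rmorph_nat; congr (_ * _).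
  by rewrite div1r invfM mulrCA mulfV ?mulr1// natr_fact_neq0.
apply/eqP; rewrite eq_complex /= !raddf_sum; apply/andP; split; apply/eqP.
- rewrite [RHS](eq_bigr (fun m : 'I_(size q) => complex.Re q`_m / m.+1%:R)).
    rewrite -(integral01_poly _ (fun m => complex.Re q`_m)).
    apply: eq_Rintegral => u _; rewrite horner_coef raddf_sum.
    by apply: eq_bigr => m _; rewrite -rmorphXn; exact: Re_mul_real.
  by move=> m _; exact: Re_mul_real.
- rewrite [RHS](eq_bigr (fun m : 'I_(size q) => complex.Im q`_m / m.+1%:R)).
    rewrite -(integral01_poly _ (fun m => complex.Im q`_m)).
    apply: eq_Rintegral => u _; rewrite horner_coef raddf_sum.
    by apply: eq_bigr => m _; rewrite -rmorphXn; exact: Im_mul_real.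
  by move=> m _; exact: Im_mul_real.
Qed.

End UnitIntervalIntegral.


Theorem theorem3p1 (R : realType) (lam : R) (p : {poly R[i]}) (n : nat) :
  lam != 0 -> size p = n.+1 ->
  let L : R[i] := (lam%:C)%C in
  (* g(t) = lam (e^t - 1)/(e^(lam t) - 1),  f(t) = (e^(lam t) - 1)/lam *)
  let g : fps R[i] :=
    fps_scale L (fps_mul (fps_divX (expm1 1)) (fps_inv (fps_divX (expm1 L)))) in
  let f : fps R[i] := fps_scale L^-1 (expm1 L) in
  let a (k : nat) : R[i] :=
    if k == 0%N then (umbral_op g p).[0]
    else ((k`!)%:R)^-1 *
           (umbral_op (fps_pow f (k.-1)) (p \Po ('X + 1) - p)).[0] in
  p = \sum_(k < n.+1) a k *: degbernoulli_poly L k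
  /\ a 0%N = umbral_pair (fps_divX (expm1 1))
               (umbral_op (fps_inv (fps_scale L^-1 (fps_divX (expm1 L)))) p)
  /\ a 0%N = cintegral01 (fun u : R => (umbral_bern L p).[(u%:C)%C])
  /\ (forall k : nat, (1 <= k <= n)%N ->
       [/\ a k = ((k`!)%:R * L ^+ k.-1)^-1 *
                   umbral_pair (fps_pow (expm1 L) k.-1) (p \Po ('X + 1) - p),
           a k = ((k`!)%:R * L ^+ k.-1)^-1 *
                   (iter k.-1 (fdiff L) (fdiff 1 p)).[0],
           a k = ((k`!)%:R * L ^+ k.-1)^-1 *
                   \sum_(j < k) ('C(k.-1, j)%:R * (-1) ^+ (k.-1 - j) *
                      (p.[1 + j%:R * L] - p.[j%:R * L]))
         & a k = (k%:R)^-1 *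
                   \sum_(k.-1 <= l < n.+1)
                      (stirling2 R[i] l k.-1 * (L ^+ (l - k.-1) / (l`!)%:R) *
                       ((p^`(l)).[1] - (p^`(l)).[0]))]).
Proof.
move=> lam0 sp L; have L0 : L != 0 by rewrite /L eq_complex /= negb_and lam0.
move: L L0 => {lam lam0} L L0 g f a.
have onePX : p \Po ('X + 1) - p = fdiff 1 p by rewrite /fdiff polyC1.
(* Both branches of [a] are values of [sheffer_coef], the first because f^0 = 1, the second by g f =
   e^t - 1. *)
have aE k : a k = sheffer_coef L k p.
  case: k => [|k]; first by rewrite horner_sheffer_coef0.
  by rewrite sheffer_coefS// -onePX.
split; last split; last split.
- rewrite {1}(@degbernoulli_expansion _ _ L0 n.+1 p) ?sp//.
  by apply: eq_bigr => k _; rewrite aE.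
- by rewrite aE sheffer_coef0_pair.
- by rewrite aE sheffer_coef0_bern// cintegral01_horner.
- move=> [//|k] _; rewrite onePX aE; split.
  + by rewrite sheffer_coefS_op// umbral_op0.
  + exact: sheffer_coefS_iter.
  + exact: sheffer_coefS_sum.
  + by apply: sheffer_coefS_stirling => //; rewrite sp.
Qed.
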